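(* Let $\Gamma=(X,R)$ be a bipartite distance-regular graph with even diameter $D\ge4$ and valency $k\ge3$, let $d=D/2$, fix $x\in X$, and let $W$ be a thin irreducible $T(x)$-module with endpoint $2$ and local eigenvalue $\tilde\theta_d$. Then $W$ has dimension $D-2$. For $0\le i\le D$, $E^*_iW$ is zero if $i\in\{0,1,D\}$ and has dimension $1$ if $2\le i\le D-1$. Moreover $E_iW$ is zero if $i\in\{0,d,D\}$ and has dimension $1$ if $1\le i\le D-1$, $i\ne d$.
   Context: $\Gamma$ is a finite connected bipartite distance-regular graph with distance $\partial$, intersection numbers $c_i,b_i$; $A_i$ distance matrices, $A=A_1$, eigenvalues $\theta_0>\dots>\theta_D$, $E_i$ primitive idempotent for $\theta_i$. $E^*_i$ is diagonal with $(y,y)$-entry $1$ if $\partial(x,y)=i$, else $0$; $T(x)$ is generated by $A,E^*_0,\dots,E^*_D$; $T$-modules are $T$-invariant subspaces of $\mathbb{C}^X$; thin: $\dim E^*_iW\le1$ for all $i$; endpoint $\min\{i:E^*_iW\ne0\}$; local eigenvalue of a thin irreducible $W$ with endpoint $2$: eigenvalue of $E^*_2A_2E^*_2$ on $E^*_2W$. $\tilde\theta_d=-1-b_2b_3(\theta_d^2-b_2)^{-1}$. *)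

(* Defs.v *)
From HB Require Import structures.
From mathcomp Require Import all_boot all_order all_algebra.
From mathcomp Require Export complex.
From mathcomp Require Export reals.

Set Implicit Arguments.
Unset Strict Implicit.
Unset Printing Implicit Defensive.

Import Order.TTheory GRing.Theory Num.Theory.

Section Graph.
Variables (X : finType) (e : rel X).

Definition simple_graph : Prop := symmetric e /\ irreflexive e.

Definition connected_graph : Prop := forall y z : X, connect e y z.

Definition bipartite : Prop :=
  exists color : X -> bool, forall y z, e y z -> color y != color z.

Definition walk_of_length (n : nat) (y z : X) : bool :=
  [exists p : n.-tuple X, path e y p && (last y p == z)].

(* Shortest walks have length < #|X|; the value is #|X| if there is no walk. *)
Definition dist (y z : X) : nat :=
  find (fun n => walk_of_length n y z) (iota 0 #|X|).

Definition diameter : nat := \max_(y : X) \max_(z : X) dist y z.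

Definition sphere (i : nat) (y : X) : {set X} := [set z | dist y z == i].

Definition distance_regular : Prop :=
  forall (h i j : nat) (y z y' z' : X), dist y z = h -> dist y' z' = h ->
    #|sphere i y :&: sphere j z| = #|sphere i y' :&: sphere j z'|.

(* p^h_{ij}, read off an arbitrary pair of vertices at distance h; it is
   independent of that pair in a distance-regular graph. *)
Definition intersection_number (h i j : nat) : nat :=
  if [pick u : X * X | dist u.1 u.2 == h] is Some u
  then #|sphere i u.1 :&: sphere j u.2| else 0.

Definition b_ (i : nat) : nat := intersection_number i 1 i.+1.

Definition valency : nat := b_ 0.

End Graph.

Local Open Scope ring_scope.

(* The unital subalgebra of 'M_n generated by S. 'M_n is not a (nontrivial)
   ring type for a general n, so {aspace _} is not available. *)
Inductive generated_algebra (C : fieldType) (n : nat) (S : 'M[C]_n -> Prop) :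
    'M[C]_n -> Prop :=
| generated_gen B : S B -> generated_algebra S B
| generated_one : generated_algebra S 1%:M
| generated_scale a B : generated_algebra S B -> generated_algebra S (a *: B)
| generated_add B B' : generated_algebra S B -> generated_algebra S B' ->
    generated_algebra S (B + B')
| generated_mul B B' : generated_algebra S B -> generated_algebra S B' ->
    generated_algebra S (B *m B').

(* The image B W of a subspace of column vectors. *)
Definition mximg (C : fieldType) (n : nat) (B : 'M[C]_n)
    (W : {vspace 'cV[C]_n}) : {vspace 'cV[C]_n} :=
  (linfun (mulmx B) @: W)%VS.

Definition primitive_idempotent (C : fieldType) (n : nat)
    (M : {vspace 'M[C]_n}) (E : 'M[C]_n) : Prop :=
  [/\ E \in M, E != 0, E *m E = E &
      ~ exists F G : 'M[C]_n,
          [/\ F \in M, G \in M, F != 0 & G != 0] /\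
          [/\ F *m F = F, G *m G = G, F *m G = 0, G *m F = 0 & E = F + G]].

(* Matrices with rows and columns indexed by X are indexed through the
   enumeration enum_val : 'I_#|X| -> X. *)
Section Matrices.
Variables (C : fieldType) (X : finType) (e : rel X).

Definition distmx (i : nat) : 'M[C]_#|X| :=
  \matrix_(r, s) (dist e (enum_val r) (enum_val s) == i)%:R.

Definition adjmx : 'M[C]_#|X| := distmx 1.

Definition bose_mesner : {vspace 'M[C]_#|X|} :=
  <<mkseq distmx (diameter e).+1>>%VS.

Variable x : X.

Definition dual_idem (i : nat) : 'M[C]_#|X| :=
  diag_mx (\row_r (dist e x (enum_val r) == i)%:R).

Definition terwilliger : 'M[C]_#|X| -> Prop :=
  generated_algebra (fun B => B = adjmx \/
    exists2 i, (i <= diameter e)%N & B = dual_idem i).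

Definition T_module (W : {vspace 'cV[C]_#|X|}) : Prop :=
  forall B, terwilliger B -> forall w, w \in W -> B *m w \in W.

Definition irreducible_T_module (W : {vspace 'cV[C]_#|X|}) : Prop :=
  [/\ T_module W, W <> 0%VS &
      forall U : {vspace 'cV[C]_#|X|}, T_module U -> (U <= W)%VS ->
        U = 0%VS \/ U = W].

Definition thin (W : {vspace 'cV[C]_#|X|}) : Prop :=
  forall i, (i <= diameter e)%N -> (\dim (mximg (dual_idem i) W) <= 1)%N.

(* min {i <= D | E*_i W <> 0}; the set is nonempty when W <> 0. *)
Definition endpoint (W : {vspace 'cV[C]_#|X|}) : nat :=
  find (fun i => mximg (dual_idem i) W != 0%VS) (iota 0 (diameter e).+1).

(* For thin W with endpoint 2, E*_2 W is a line, so eta is unique. *)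
Definition local_eigenvalue (W : {vspace 'cV[C]_#|X|}) (eta : C) : Prop :=
  exists2 w, w \in mximg (dual_idem 2) W &
    w != 0 /\ dual_idem 2 *m distmx 2 *m dual_idem 2 *m w = eta *: w.

End Matrices.

Definition theta_tilde (C : fieldType) (X : finType) (e : rel X) (t : C) : C :=
  - 1 - (b_ e 2)%:R * (b_ e 3)%:R * (t ^+ 2 - (b_ e 2)%:R)^-1.

(* theta_0 > ... > theta_D are the eigenvalues of A; the order of R[i]
   compares only numbers with equal imaginary part. *)
Definition ordered_eigenvalues (C : numClosedFieldType) (X : finType)
    (e : rel X) (theta : nat -> C) : Prop :=
  (forall i j, (i < j <= diameter e)%N -> theta j < theta i) /\
  (forall a, eigenvalue (adjmx C e) a <->
     exists2 i, (i <= diameter e)%N & a = theta i).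

Definition idempotents_for (C : fieldType) (X : finType) (e : rel X)
    (theta : nat -> C) (E : nat -> 'M[C]_#|X|) : Prop :=
  forall i, (i <= diameter e)%N ->
    primitive_idempotent (bose_mesner C e) (E i) /\
    adjmx C e *m E i = theta i *: E i.

(* Main.v *)
(* Let v span E*_2 W.  As W is thin and irreducible, W is generated by v under A,
   and an eigenvector of A in W whose component in E*_2 W is 0 vanishes.  Hence
   E_i W is spanned by E_i v, and E_i v = 0 iff E*_2 E_i v = 0.  Writing
   E_i = sum_h F_h A_h, bipartiteness, the local eigenvalue b_3 - 1 (theta_d is 0)
   and the fact that the entries of v sum to 0 give
     E*_2 E_i v = (F_0 + F_2 (b_3 - 1) - F_4 b_3) v,
   and the three-term recurrence for F turns the scalar into
     theta_i^2 (k^2 - theta_i^2) F_0 / (b_0 b_1 b_2),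
   which vanishes exactly for i in {0, d, D}.  So dim W = D - 2.  The supports
   E*_i W are gapless from i = 2 on, so this dimension forces E*_D W = 0. *)
Require Import Defs.
From mathcomp Require Import all_boot all_order all_algebra.
From mathcomp Require Import zify ring.

Set Implicit Arguments.
Unset Strict Implicit.
Unset Printing Implicit Defensive.

Import Order.TTheory GRing.Theory Num.Theory.
Local Open Scope ring_scope.

(** * Walks and the path metric of a connected graph *)

Section Distance.
Variables (X : finType) (e : rel X).
Hypotheses (e_simple : simple_graph e) (e_conn : connected_graph e).

Lemma walk_of_lengthP n y z :
  reflect (exists p, [/\ size p = n, path e y p & last y p = z])
          (walk_of_length e n y z).
Proof.
apply: (iffP existsP) => [[p /andP[yp /eqP zp]]|[p [sp yp zp]]].
  by exists p; rewrite size_tuple.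
have sp' : size p == n by apply/eqP.
by exists (Tuple sp'); rewrite /= yp zp eqxx.
Qed.

Lemma walk_of_length0 y z : walk_of_length e 0 y z = (y == z).
Proof.
apply/walk_of_lengthP/eqP => [[p [/size0nil-> _ <-]] //|<-].
by exists [::].
Qed.

Lemma walk_of_lengthS n y z :
  walk_of_length e n.+1 y z = [exists w, e y w && walk_of_length e n w z].
Proof.
apply/walk_of_lengthP/existsP.
  move=> [[|w p] []] // [sp] /= /andP[yw wp] zp.
  by exists w; rewrite yw; apply/walk_of_lengthP; exists p.
move=> [w /andP[yw /walk_of_lengthP[p [sp wp zp]]]].
by exists (w :: p); rewrite /= sp yw.
Qed.

Lemma walk_of_lengthSr n y w z :
  walk_of_length e n y w -> e w z -> walk_of_length e n.+1 y z.
Proof.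
move=> /walk_of_lengthP[p [sp yp lp]] wz; apply/walk_of_lengthP.
by exists (rcons p z); rewrite size_rcons sp rcons_path yp lp last_rcons.
Qed.

Lemma walk_of_length_sym n y z :
  walk_of_length e n y z -> walk_of_length e n z y.
Proof.
elim: n y z => [|n IHn] y z; first by rewrite !walk_of_length0 eq_sym.
rewrite walk_of_lengthS => /existsP[w /andP[yw /IHn zw]].
by apply: walk_of_lengthSr zw _; rewrite e_simple.1.
Qed.

(** A path without repeated vertices has fewer than [#|X|] edges, so connectedness makes the bounded
    search in [dist] succeed. *)
Lemma walk_of_length_dist y z : walk_of_length e (dist e y z) y z.
Proof.
case/connectP: (e_conn y z) => p /shortenP[q yq uq _] zq.
have sq : (size q < #|X|)%N by rewrite -[_.+1]/(size (y :: q)) -(card_uniqP uq) max_card.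
have hasW : has (fun n => walk_of_length e n y z) (iota 0 #|X|).
  apply/hasP; exists (size q); first by rewrite mem_iota.
  by apply/walk_of_lengthP; exists q.
have := nth_find 0%N hasW; rewrite nth_iota ?add0n //.
by rewrite has_find size_iota in hasW.
Qed.

Lemma dist_le_walk n y z : walk_of_length e n y z -> (dist e y z <= n)%N.
Proof.
move=> wn; have [ltn|] := ltnP n #|X|.
  rewrite leqNgt; apply/negP => /(before_find 0%N).
  by rewrite nth_iota // add0n wn.
by apply: leq_trans; rewrite /dist -[leqRHS](size_iota 0); exact: find_size.
Qed.

Lemma dist_sym y z : dist e y z = dist e z y.
Proof.
by apply/eqP; rewrite eqn_leq !dist_le_walk // walk_of_length_sym ?walk_of_length_dist.
Qed.

Lemma dist_eq0 y z : (dist e y z == 0%N) = (y == z).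
Proof.
apply/eqP/eqP => [d0|<-].
  by have := walk_of_length_dist y z; rewrite d0 walk_of_length0 => /eqP.
by apply/eqP; rewrite -leqn0 dist_le_walk ?walk_of_length0.
Qed.

Lemma dist_eq1 y z : (dist e y z == 1%N) = e y z.
Proof.
apply/eqP/idP => [d1|yz].
  have := walk_of_length_dist y z; rewrite d1 walk_of_lengthS.
  by move=> /existsP[w /andP[yw]]; rewrite walk_of_length0 => /eqP <-.
apply/eqP; rewrite eqn_leq dist_le_walk ?lt0n ?dist_eq0 /=; last first.
  by rewrite walk_of_lengthS; apply/existsP; exists z; rewrite yz walk_of_length0 /=.
by apply: contraTneq yz => ->; rewrite e_simple.2.
Qed.

Lemma dist_edge y w z : e y w -> (dist e y z <= (dist e w z).+1)%N.
Proof.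
move=> yw; apply: dist_le_walk; rewrite walk_of_lengthS; apply/existsP.
by exists w; rewrite yw walk_of_length_dist.
Qed.

Lemma dist_pred h y z : dist e y z = h.+1 ->
  exists2 w, e y w & dist e w z = h.
Proof.
move=> dyz; have := walk_of_length_dist y z; rewrite dyz walk_of_lengthS.
move=> /existsP[w /andP[yw /dist_le_walk le_h]]; exists w => //.
by apply/eqP; rewrite eqn_leq le_h -ltnS -dyz dist_edge.
Qed.

Lemma dist_triangle y z w : (dist e y w <= dist e y z + dist e z w)%N.
Proof.
move: {2}(dist e y z) (erefl (dist e y z)) => h; elim: h y => [|h IHh] y dyz.
  by have /eqP := dyz; rewrite dist_eq0 => /eqP ->; rewrite leq_addl.
have [t yt dtz] := dist_pred dyz.
by apply: leq_trans (dist_edge w yt) _; rewrite dyz addSn ltnS -dtz IHh.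
Qed.

Lemma dist_le_diameter y z : (dist e y z <= diameter e)%N.
Proof.
rewrite /diameter; apply: leq_trans (leq_bigmax y).
exact: (leq_bigmax (F := fun z => dist e y z)).
Qed.

(** Descend along a geodesic from a pair at distance [diameter e]; positivity of the diameter
    guarantees that there is a vertex at all. *)
Lemma dist_attained h : (h <= diameter e)%N -> (0 < diameter e)%N ->
  exists y z, dist e y z = h.
Proof.
move=> le_hD D_gt0.
have [X0|X_gt0] := posnP #|X|.
  by move: D_gt0; rewrite /diameter big_pred0 // => y; have := card0_eq X0 y.
have [y Dy] := @bigop.eq_bigmax X (fun y => \max_z dist e y z) X_gt0.
have [z Dyz] := @bigop.eq_bigmax X (dist e y) X_gt0.
have : dist e y z = diameter e by rewrite /diameter Dy.
move: y z {Dy Dyz}; move: le_hD; move: (diameter e) => m.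
elim: m => [|m IHm] le_hm y z d_yz.
  by exists y, z; rewrite d_yz; move: le_hm; rewrite leqn0 => /eqP.
move: le_hm; rewrite leq_eqVlt => /predU1P[->|]; first by exists y, z.
rewrite ltnS => le_hm; have [w _ dw] := dist_pred d_yz.
exact: IHm le_hm _ _ dw.
Qed.

End Distance.

(** * Intersection numbers of a bipartite distance-regular graph *)

Section IntersectionNumbers.
Variables (X : finType) (e : rel X).
Hypotheses (e_simple : simple_graph e) (e_conn : connected_graph e).
Hypotheses (e_bip : bipartite e) (e_dr : distance_regular e).

Lemma intersection_numberE h i j y z : dist e y z = h ->
  intersection_number e h i j = #|sphere e i y :&: sphere e j z|.
Proof.
move=> dyz; rewrite /intersection_number; case: pickP => [u /eqP du|].
  exact: e_dr du dyz.
by move/(_ (y, z)); rewrite dyz eqxx.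
Qed.

(** At [h = 0] the truncated predecessor gives [p^0_{1,0}], which is 0 as [c_0] confirms. *)
Definition c_ (h : nat) := intersection_number e h 1 h.-1.

(** The length of any walk from [a] to [b] is odd exactly when the colours of [a] and [b] differ. *)
Lemma odd_dist y z w : odd (dist e y w) = odd (dist e y z) (+) odd (dist e z w).
Proof.
have [color col] := e_bip.
have odd_walk n a b : walk_of_length e n a b -> odd n = (color a != color b).
  elim: n a b => [|n IHn] a b.
    by rewrite walk_of_length0 => /eqP ->; rewrite eqxx.
  rewrite walk_of_lengthS => /existsP[t /andP[/col cat /IHn] /=] ->.
  by move: cat; case: (color a) (color t) (color b) => [] [] [].
rewrite !(odd_walk _ _ _ (walk_of_length_dist e_conn _ _)).
by case: (color y) (color w) (color z) => [] [] [].
Qed.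

Lemma dist_neighbour y w z : e y w ->
  (dist e w z == (dist e y z).+1) || ((dist e w z).+1 == dist e y z).
Proof.
move=> yw; have := odd_dist y w z.
have /eqP -> : dist e y w == 1%N by rewrite dist_eq1.
have := dist_edge e_conn z yw; rewrite e_simple.1 in yw.
have := dist_edge e_conn z yw; lia.
Qed.

(** By bipartiteness no neighbour of [y] is as far from [z] as [y] itself, so the neighbours split
    into a closer class counted by [c_] and a farther one counted by [b_]. Every three-term
    recurrence below comes from this. *)
Lemma sum_neighbours (C : pzRingType) (F : nat -> C) y z :
  \sum_w (dist e y w == 1%N)%:R * F (dist e w z) =
  (c_ (dist e y z))%:R * F (dist e y z).-1
  + (b_ e (dist e y z))%:R * F (dist e y z).+1.
Proof.
rewrite /c_ /b_ !(@intersection_numberE _ _ _ y z) //.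
have card_sum (S : {set X}) a : #|S|%:R * a = \sum_w (w \in S)%:R * a :> C.
  rewrite -sum1_card natr_sum mulr_suml big_mkcond /=.
  by apply: eq_bigr => w _; case: (w \in S); rewrite ?mul0r.
rewrite !card_sum -big_split; apply: eq_bigr => w _ /=.
rewrite !inE; have [yw|_] := boolP (dist e y w == 1%N); last by rewrite !mul0r addr0.
rewrite dist_eq1 // in yw; have := dist_neighbour z yw.
rewrite ![dist e z _]dist_sym // !mul1r /=.
case/orP => /eqP; last first.
  by move=> <- /=; rewrite eqxx mul1r (_ : (_ == _.+2) = false) ?mul0r ?addr0 //; lia.
by move=> -> /=; rewrite eqxx mul1r (_ : (_ == _) = false) ?mul0r ?add0r //; lia.
Qed.

Lemma b_gt0 h : (h < diameter e)%N -> (0 < b_ e h)%N.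
Proof.
move=> ltD; have [w [z dwz]] := dist_attained e_conn ltD (leq_ltn_trans (leq0n _) ltD).
have [y wy dyz] := dist_pred e_conn dwz.
rewrite /b_ (intersection_numberE _ _ dyz); apply/card_gt0P; exists w.
by rewrite !inE dist_eq1 // e_simple.1 wy /= dist_sym // dwz.
Qed.

Lemma c_gt0 h : (h < diameter e)%N -> (0 < c_ h.+1)%N.
Proof.
move=> ltD; have [w [z dwz]] := dist_attained e_conn ltD (leq_ltn_trans (leq0n _) ltD).
have [y wy dyz] := dist_pred e_conn dwz.
rewrite /c_ (intersection_numberE _ _ dwz); apply/card_gt0P; exists y.
by rewrite !inE dist_eq1 // wy /= dist_sym // dyz.
Qed.

Lemma card_neighbours y : #|sphere e 1 y| = valency e.
Proof.
rewrite /valency /b_ (@intersection_numberE _ _ _ y y); last by apply/eqP; rewrite dist_eq0.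
by rewrite setIid.
Qed.

Lemma c_plus_b h : (h <= diameter e)%N -> (0 < diameter e)%N ->
  (c_ h + b_ e h)%N = valency e.
Proof.
move=> hD D0; have [y [z dyz]] := dist_attained e_conn hD D0.
have := sum_neighbours (fun=> 1%R : int) y z.
rewrite -(card_neighbours y) dyz !mulr1 -natrD => E.
apply/eqP; rewrite -eqz_nat -!natz -E; apply/eqP.
rewrite -sum1_card natr_sum [RHS]big_mkcond /=.
by apply: eq_bigr => w _; rewrite mulr1 inE; case: (_ == _).
Qed.

Lemma c_0 : (0 < diameter e)%N -> c_ 0 = 0%N.
Proof. by move=> D0; have := @c_plus_b 0 isT D0; rewrite /valency; lia. Qed.

Lemma c_1 : (0 < diameter e)%N -> c_ 1 = 1%N.
Proof.
move=> D0; have [y [z dyz]] := dist_attained e_conn D0 D0.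
rewrite /c_ (intersection_numberE _ _ dyz) (_ : _ :&: _ = [set z]) ?cards1 //.
apply/setP => w; rewrite !inE dist_eq0 // [z == w]eq_sym andbC.
by case: eqP => // ->; rewrite dyz.
Qed.

End IntersectionNumbers.

(** * Images of subspaces under matrices *)

Section MatrixImage.
Variables (C : fieldType) (n : nat).
Implicit Types (B : 'M[C]_n) (W U : {vspace 'cV[C]_n}) (u w : 'cV[C]_n).

Lemma mximgP B W u :
  reflect (exists2 w, w \in W & u = B *m w) (u \in mximg B W).
Proof.
apply: (iffP memv_imgP) => [[w wW ->]|[w wW ->]]; exists w => //;
  by rewrite lfunE.
Qed.

Lemma mem_mximg B W w : w \in W -> B *m w \in mximg B W.
Proof. by move=> wW; apply/mximgP; exists w. Qed.

Lemma mximg_eq0P B W :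
  reflect (forall w, w \in W -> B *m w = 0) (mximg B W == 0%VS).
Proof.
rewrite -subv0; apply: (iffP subvP) => [BW0 w wW|BW0 u /mximgP[w wW ->]].
  by apply/eqP; rewrite -memv0 BW0 ?mem_mximg.
by rewrite BW0 ?mem0v.
Qed.

Lemma dim_le1_scale U u w : (\dim U <= 1)%N -> u \in U -> u != 0 ->
  w \in U -> exists a, w = a *: u.
Proof.
move=> dimU uU u0 wU; suff : w \in <[u]>%VS by case/vlineP => a ->; exists a.
have /eqP -> // : (<[u]> == U)%VS.
by rewrite eqEdim -memvE uU dim_vline u0.
Qed.

Lemma mem_lker_mul B w : (w \in lker (linfun (mulmx B))) = (B *m w == 0).
Proof. by rewrite memv_ker lfunE. Qed.

(** Orthogonality makes the sum of the images direct, and completeness makes it all of [W]. It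
    serves both for the [E_i] and for the [E*_i]. *)
Lemma dim_idempotents N (F : nat -> 'M[C]_n) W :
  (forall i j, (i < N)%N -> (j < N)%N ->
     F i *m F j = if i == j then F i else 0) ->
  \sum_(i < N) F i = 1%:M ->
  (forall i w, (i < N)%N -> w \in W -> F i *m w \in W) ->
  \dim W = (\sum_(i < N) \dim (mximg (F i) W))%N.
Proof.
move=> FF F1 FW.
have fixF (i : 'I_N) u : u \in mximg (F i) W -> F i *m u = u.
  by case/mximgP => w _ ->; rewrite mulmxA FF // eqxx.
have dirF : directv (\sum_(i < N) mximg (F i) W)%VS.
  apply/directv_sum_independent => us usF us0 i _.
  have := congr1 (mulmx (F i)) us0; rewrite mulmx0 mulmx_sumr (bigD1 i) //=.
  rewrite big1 ?addr0 => [|j ji]; first by rewrite fixF ?usF.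
  by rewrite -(fixF j (us j)) ?usF // mulmxA FF // val_eqE eq_sym (negbTE ji) mul0mx.
rewrite -(directvP dirF) /=; congr (\dim _); apply/eqP; rewrite eqEsubv.
apply/andP; split; last first.
  by apply/subv_sumP => i _; apply/subvP => u /mximgP[w wW ->]; exact: FW.
apply/subvP => w wW; rewrite -[w]mul1mx -F1 mulmx_suml memv_sumr // => i _.
exact: mem_mximg.
Qed.

End MatrixImage.

(** * Thin irreducible modules for a matrix banded with respect to a grading [g] *)

Section LayeredModule.
Variables (C : fieldType) (n D : nat) (g : 'I_n -> nat) (A : 'M[C]_n).
Hypotheses (le_gD : forall r, (g r <= D)%N)
  (A_band : forall r s, A r s != 0 -> (g r <= (g s).+1)%N && (g s <= (g r).+1)%N).

(** With [g] the distance from [x] this is convertible to [dual_idem]. *)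
Definition layer i : 'M[C]_n := diag_mx (\row_r (g r == i)%:R).

Lemma layerE i (w : 'cV[C]_n) r : (layer i *m w) r 0 = (g r == i)%:R * w r 0.
Proof. by rewrite mul_diag_mx !mxE. Qed.

Lemma layer_eq0P i (w : 'cV[C]_n) :
  layer i *m w = 0 <-> forall r, g r = i -> w r 0 = 0.
Proof.
split=> [w0 r gr|w0].
  by have := congr1 (fun u : 'cV_n => u r 0) w0; rewrite layerE gr eqxx mul1r mxE.
apply/matrixP => r s; rewrite ord1 layerE mxE.
by case: eqP => [/w0 ->|_]; rewrite ?mulr0 ?mul0r.
Qed.

Lemma mul_layer i j : layer i *m layer j = if i == j then layer i else 0.
Proof.
apply/matrixP => r s; rewrite mul_diag_mx !mxE mulrnAr -natrM mulnb.
have [<-|ij] := eqVneq i j; first by rewrite andbb !mxE.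
suff -> : (g r == i) && (g r == j) = false by rewrite mul0rn mxE.
by apply/negbTE; apply: contraNN ij => /andP[/eqP <-].
Qed.

Lemma sum_layer : \sum_(i < D.+1) layer i = 1%:M.
Proof.
apply/matrixP => r s; rewrite summxE !mxE.
rewrite (bigD1 (Ordinal (le_gD r : g r < D.+1)%N)) //= big1 ?addr0 ?mxE ?eqxx //.
move=> i ig; rewrite !mxE (_ : (g r == i) = false) ?mul0rn //.
by apply: contraNF ig => /eqP gi; apply/eqP/val_inj.
Qed.

Variable W : {vspace 'cV[C]_n}.
Hypotheses (AW : forall w, w \in W -> A *m w \in W)
  (PW : forall i w, (i <= D)%N -> w \in W -> layer i *m w \in W).
Hypothesis irrW : forall U : {vspace 'cV[C]_n}, (U <= W)%VS ->
  (forall u, u \in U -> A *m u \in U) ->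
  (forall i u, (i <= D)%N -> u \in U -> layer i *m u \in U) ->
  U = 0%VS \/ U = W.
Hypothesis thinW : forall i, (i <= D)%N -> (\dim (mximg (layer i) W) <= 1)%N.

Definition supported_on (S : pred nat) (w : 'cV[C]_n) :=
  forall r, ~~ S (g r) -> w r 0 = 0.

(** Cut out by the kernel of the projection onto the layers outside [S], so as to be a subspace. It
    is used with [geq j], the layers up to [j], and [leq j], the layers from [j] on. *)
Definition restriction (S : pred nat) : {vspace 'cV[C]_n} :=
  (W :&: lker (linfun (mulmx (diag_mx (\row_r (~~ S (g r))%:R)))))%VS.

Lemma mem_restriction (S : pred nat) w :
  w \in restriction S <-> w \in W /\ supported_on S w.
Proof.
rewrite memv_cap mem_lker_mul; split=> [/andP[-> /eqP Bw0]|[-> Sw]].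
  split=> // r Sr; have := congr1 (fun u : 'cV_n => u r 0) Bw0.
  by rewrite mul_diag_mx !mxE Sr mul1r.
apply/eqP/matrixP => r s; rewrite ord1 mul_diag_mx !mxE.
by have [_|/Sw ->] := boolP (S (g r)); rewrite ?mul0r ?mulr0.
Qed.

Lemma subscaleE a (u w : 'cV[C]_n) r : (w - a *: u) r 0 = w r 0 - a * u r 0.
Proof. by rewrite !mxE. Qed.

Lemma supported_on_mul (S : pred nat) w r : supported_on S w ->
  (forall s, A r s != 0 -> ~~ S (g s)) -> (A *m w) r 0 = 0.
Proof.
move=> Sw rS; rewrite mxE big1 // => s _.
by have [->|/rS/Sw ->] := eqVneq (A r s) 0; rewrite ?mul0r ?mulr0.
Qed.

(** Projections to layers never enlarge a support, so only invariance under [A] has to be supplied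
    to irreducibility. *)
Lemma restriction_dichotomy (S : pred nat) :
  (forall w, w \in W -> supported_on S w -> supported_on S (A *m w)) ->
  restriction S = 0%VS \/ restriction S = W.
Proof.
move=> AS; apply: irrW; first exact: capvSl.
  by move=> u /mem_restriction[uW Su]; apply/mem_restriction; split; auto.
move=> i u iD /mem_restriction[uW Su]; apply/mem_restriction; split; auto.
by move=> r Sr; rewrite layerE Su ?mulr0.
Qed.

Lemma layer_mximg_scale i u w : (i <= D)%N -> u \in W -> layer i *m u != 0 ->
  w \in W -> exists a, layer i *m w = a *: (layer i *m u).
Proof.
by move=> iD uW u0 wW; apply: dim_le1_scale (thinW iD) _ u0 _; apply: mem_mximg.
Qed.

Variable m : nat.
Hypotheses (le_mD : (m <= D)%N) (W_above : forall w, w \in W -> supported_on (leq m) w)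
  (W_m : exists2 w, w \in W & layer m *m w != 0).

(* The layers up to j then form a nonzero submodule. *)
Lemma restriction_raising_eq0 j : (m <= j)%N ->
  (forall w, w \in W -> supported_on (geq j) w -> layer j.+1 *m (A *m w) = 0) ->
  restriction (geq j) = W.
Proof.
move=> mj raise0.
have [R0|//] : restriction (geq j) = 0%VS \/ restriction (geq j) = W.
  apply: restriction_dichotomy => w wW Sw r; rewrite -ltnNge leq_eqVlt.
  case/predU1P => [jr|jr].
    by have /layer_eq0P := raise0 w wW Sw; apply.
  apply: supported_on_mul Sw _ => s /A_band /andP[rs _].
  by rewrite -ltnNge; move: (leq_trans jr rs).
have [w wW /negP[]] := W_m; rewrite -memv0 -R0.
apply/mem_restriction; split=> [|r]; first exact: PW.
rewrite -ltnNge => jr; rewrite layerE (_ : (g r == m) = false) ?mul0r //.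
by apply/eqP; lia.
Qed.

(** Thus [W] is generated by [v] under [A] alone. By induction on [j], the vectors of [W] supported
    in the layers [m] to [j] lie in [U]: thinness makes each layer at most a line, and [A] raises
    into the next one. *)
Lemma cyclic_submodule (U : {vspace 'cV[C]_n}) v : v \in W -> layer m *m v = v ->
  v != 0 -> v \in U -> (U <= W)%VS -> (forall u, u \in U -> A *m u \in U) -> U = W.
Proof.
move=> vW Pv v0 vU UW AU; apply/eqP; rewrite eqEsubv UW /=.
suff geqU j : (m <= j <= D)%N -> (restriction (geq j) <= U)%VS.
  apply: subv_trans (geqU D _); last by rewrite le_mD leqnn.
  by apply/subvP => w wW; apply/mem_restriction; split=> // r; rewrite /= le_gD.
case/andP=> mj; rewrite -(subnKC mj); elim: (j - m)%N => [|i IHi] iD.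
  apply/subvP => w /mem_restriction[wW Sw].
  have -> : w = layer m *m w.
    apply/matrixP => r s; rewrite ord1 layerE.
    case: ltngtP => [gm|mg|_]; rewrite ?mul1r // mul0r.
      by apply: W_above => //; rewrite -ltnNge.
    by apply: Sw; rewrite addn0 -ltnNge.
  have [|a ->] := layer_mximg_scale le_mD vW _ wW; rewrite Pv //.
  by rewrite memvZ.
move: iD; rewrite addnS; set l := (m + i)%N in IHi * => lD.
have RlU := IHi (ltnW lD).
(* If [A] raises nothing from the layers up to [l] into layer [l + 1], those layers already fill
   [W]; otherwise some [A *m u] spans the next layer. *)
have [raise0|] := boolP (restriction (geq l) <=
    lker (linfun (mulmx (layer l.+1 *m A))))%VS.
  apply: subv_trans RlU; rewrite (restriction_raising_eq0 (leq_addr i m)) ?capvSl //.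
  move=> w wW Sw; have /(subvP raise0) : w \in restriction (geq l).
    exact/mem_restriction.
  by rewrite mem_lker_mul mulmxA => /eqP.
case/subvPn => u uR; rewrite mem_lker_mul -mulmxA => z0.
have [uW Su] := (mem_restriction _ _).1 uR.
apply/subvP => w /mem_restriction[wW Sw].
have [a wa] := layer_mximg_scale lD (AW uW) z0 wW.
(* Subtracting the multiple of [A *m u] that cancels layer [l + 1] leaves a vector supported up to
   [l], to which the induction hypothesis applies. *)
rewrite -[w](subrK (a *: (A *m u))) memvD ?memvZ ?AU ?(subvP RlU) //.
apply/mem_restriction; split; first by rewrite memvB ?memvZ ?AW.
move=> r; rewrite -ltnNge leq_eqVlt subscaleE => /predU1P[lr|lr].
  have := congr1 (fun u : 'cV_n => u r 0) wa.
  by rewrite [in RHS]mxE !layerE -lr eqxx !mul1r => ->; rewrite subrr.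
rewrite Sw -?ltnNge // (supported_on_mul Su) ?mulr0 ?subrr // => s.
by move=> /A_band /andP[rs _]; rewrite -ltnNge; move: (leq_trans lr rs).
Qed.

(** Push the support of [u] upwards layer by layer. If [u], supported from layer [l + 1] on, has a
    nonzero part there, thinness writes every such [w] as a multiple of [u] plus a vector supported
    from [l + 2] on, and [A] brings neither down to layer [l]. These [w] then form a submodule,
    which misses layer [m] and hence is zero. *)
Lemma eigenvector_layer_neq0 (t : C) u : u \in W -> A *m u = t *: u ->
  layer m *m u = 0 -> u = 0.
Proof.
move=> uW Au Pu0.
have supp j : supported_on (leq (m + j).+1) u.
  elim: j => [|j IHj] r; rewrite -ltnNge ltnS ?addn0 ?addnS leq_eqVlt.
    case/predU1P => [gm|gm]; first by have /layer_eq0P := Pu0; apply.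
    by apply: W_above => //; rewrite -ltnNge.
  set l := (m + j)%N in IHj *.
  case/predU1P => [gl|gl]; last by apply: IHj; rewrite -ltnNge.
  have [/layer_eq0P/(_ r gl)//|Pu] := eqVneq (layer l.+1 *m u) 0.
  have : restriction (leq l.+1) = 0%VS \/ restriction (leq l.+1) = W.
    apply: restriction_dichotomy => w wW Sw s; rewrite -ltnNge ltnS => sl.
    have lD : (l.+1 <= D)%N by rewrite -gl.
    have [a wa] := layer_mximg_scale lD uW Pu wW.
    rewrite -[w](subrK (a *: u)) mulmxDr -scalemxAr Au scalerA.
    rewrite mxE [X in _ + X]mxE IHj ?mulr0 ?addr0 -?ltnNge //.
    rewrite mxE big1 // => s' _.
    have [->|/A_band /andP[_ ss']] := eqVneq (A s s') 0; first by rewrite mul0r.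
    rewrite subscaleE; suff -> : w s' 0 = a * u s' 0 by rewrite subrr mulr0.
    have := congr1 (fun u : 'cV_n => u s' 0) wa; rewrite [in RHS]mxE !layerE.
    have [_|s'l _] := eqVneq (g s') l.+1; first by rewrite !mul1r.
    have s'l' : (g s' < l.+1)%N by rewrite ltn_neqAle s'l (leq_trans ss').
    by rewrite Sw ?IHj ?mulr0 -?ltnNge.
  case=> [R0|RW].
    have : u \in restriction (leq l.+1) by apply/mem_restriction.
    by rewrite R0 memv0 => /eqP ->; rewrite mxE.
  have [w] := W_m; rewrite -RW => /mem_restriction[_ Sw] /eqP; case.
  by apply/layer_eq0P => s gs; apply: Sw; rewrite gs -ltnNge ltnS leq_addr.
apply/matrixP => r s; rewrite ord1 (supp D) ?mxE // -ltnNge ltnS.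
by apply: leq_trans (le_gD r) _; rewrite leq_addl.
Qed.

(** Nothing can be raised into an empty layer [j + 1], so the layers up to [j] fill [W]. *)
Lemma layer_gap j : (m <= j)%N -> mximg (layer j.+1) W = 0%VS ->
  forall i, (j < i)%N -> mximg (layer i) W = 0%VS.
Proof.
move=> mj /eqP/mximg_eq0P gap i ji; apply/eqP/mximg_eq0P => w.
rewrite -{1}(@restriction_raising_eq0 j) // => [/mem_restriction[wW Sw]|w' w'W _].
  by apply/layer_eq0P => r gr; apply: Sw; rewrite gr -ltnNge.
by apply: gap; apply: AW.
Qed.

End LayeredModule.

(** * The Bose-Mesner algebra through functions of the distance *)

Section BoseMesner.
Variables (C : numClosedFieldType) (X : finType) (e : rel X).
Hypotheses (e_simple : simple_graph e) (e_conn : connected_graph e).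
Hypotheses (e_bip : bipartite e) (e_dr : distance_regular e).
Hypothesis D_gt0 : (0 < diameter e)%N.
Local Notation D := (diameter e).
Local Notation A := (adjmx C e).
Local Notation c h := ((c_ e h)%:R : C).
Local Notation b h := ((b_ e h)%:R : C).

(** The general element [\sum_h F h *: A_h] of the Bose-Mesner algebra; only the values of [F] up to
    [D] matter. *)
Definition radial (F : nat -> C) : 'M[C]_#|X| :=
  \matrix_(r, s) F (dist e (enum_val r) (enum_val s)).

Lemma eq_radial (F G : nat -> C) :
  (forall h, (h <= D)%N -> F h = G h) -> radial F = radial G.
Proof. by move=> FG; apply/matrixP => r s; rewrite !mxE FG ?dist_le_diameter. Qed.

Lemma radial_inj (F G : nat -> C) h :
  radial F = radial G -> (h <= D)%N -> F h = G h.
Proof.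
move=> FG hD; have [y [z dyz]] := dist_attained e_conn hD D_gt0.
have := congr1 (fun M : 'M_#|X| => M (enum_rank y) (enum_rank z)) FG.
by rewrite !mxE !enum_rankK dyz.
Qed.

Lemma sum_enum_val (F : X -> C) : \sum_(r < #|X|) F (enum_val r) = \sum_y F y.
Proof. by rewrite [RHS](reindex _ (onW_bij _ (@enum_val_bij X))). Qed.

Lemma adjmx_mul_radial F :
  A *m radial F = radial (fun h => c h * F h.-1 + b h * F h.+1).
Proof.
apply/matrixP => r s; rewrite !mxE -(sum_neighbours e_simple e_conn e_bip e_dr).
rewrite -sum_enum_val; apply: eq_bigr => t _.
by rewrite !mxE.
Qed.

Lemma tr_radial F : (radial F)^T = radial F.
Proof. by apply/matrixP => r s; rewrite !mxE dist_sym. Qed.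

(** [A *m radial F] is again radial, hence symmetric, and symmetric matrices with a symmetric
    product commute. *)
Lemma adjmx_radialC F : A *m radial F = radial F *m A.
Proof.
have AF_tr : (A *m radial F)^T = A *m radial F.
  by rewrite adjmx_mul_radial tr_radial.
by rewrite -AF_tr trmx_mul tr_radial (tr_radial (fun h => (h == 1%N)%:R)).
Qed.

Lemma bose_mesnerP M : M \in bose_mesner C e -> exists F, M = radial F.
Proof.
set S := in_tuple (mkseq (distmx C e) D.+1) => MB.
exists (fun h : nat => \sum_i coord S i M * (h == i :> nat)%:R).
rewrite [LHS](coord_span (X := S) MB).
apply/matrixP => r s; rewrite summxE !mxE; apply: eq_bigr => i _.
have iD : (i < D.+1)%N by have := ltn_ord i; rewrite [X in (_ < X)%N]size_mkseq.
by rewrite mxE /= nth_mkseq // mxE.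
Qed.

Lemma bose_mesner1 : 1%:M \in bose_mesner C e.
Proof.
have -> : 1%:M = distmx C e 0.
  by apply/matrixP => r s; rewrite !mxE dist_eq0 // (inj_eq enum_val_inj).
by apply: memv_span; apply: map_f; rewrite mem_iota.
Qed.

(** The relation [A A_{i+1} = b_i A_i + c_{i+2} A_{i+2}] can be solved for [A_{i+2}], since
    [c_{i+2}] is nonzero for [i + 2 <= D]. *)
Lemma terwilliger_distmx x i : (i <= D)%N -> terwilliger e x (distmx C e i).
Proof.
elim/ltn_ind: i => -[_ _|[_ _|i IHi iD]].
- have -> : distmx C e 0 = 1%:M.
    by apply/matrixP => r s; rewrite !mxE dist_eq0 // (inj_eq enum_val_inj).
  exact: generated_one.
- by apply: generated_gen; left.
have -> : distmx C e i.+2 = (c i.+2)^-1 *: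
    (A *m distmx C e i.+1 + (- b i) *: distmx C e i).
  rewrite -[distmx C e i.+1]/(radial (fun h => (h == i.+1)%:R)) adjmx_mul_radial.
  apply/matrixP => r s; rewrite !mxE; move: (dist _ _ _) => h.
  have c0 : c i.+2 != 0 by rewrite pnatr_eq0 -lt0n c_gt0.
  have [->|hi] := eqVneq h i.+2.
    have -> : (i.+3 == i.+1) = false by lia.
    have -> : (i.+2 == i) = false by lia.
    by rewrite eqxx !mulr0 !addr0 mulr1 mulVf.
  have [->|hi'] := eqVneq h i.
    have -> : (i.-1 == i.+1) = false by lia.
    by rewrite eqxx mulr0 add0r !mulr1 subrr mulr0.
  rewrite eqSS (negbTE hi') !mulr0 !addr0.
  have -> : (h.-1 == i.+1) = false by lia.
  by rewrite !mulr0.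
apply: generated_scale; apply: generated_add; last first.
  by apply/generated_scale/IHi; lia.
apply: generated_mul; first by apply: generated_gen; left.
by apply: IHi; lia.
Qed.

Lemma bose_mesner_mul x W M w : T_module e x W -> M \in bose_mesner C e ->
  w \in W -> M *m w \in W.
Proof.
move=> TW MB wW.
rewrite (coord_span (X := in_tuple (mkseq (distmx C e) D.+1)) MB).
rewrite mulmx_suml memv_suml // => i _.
have iD : (i < D.+1)%N by have := ltn_ord i; rewrite [X in (_ < X)%N]size_mkseq.
by rewrite -scalemxAl memvZ //= nth_mkseq // TW //; apply: terwilliger_distmx.
Qed.

(** * The coefficients of a radial eigenmatrix of [A] *)

Section Eigenmatrix.
Variables (t : C) (F : nat -> C).
Hypothesis AF : A *m radial F = t *: radial F.

Lemma eigen_recurrence h : (h <= D)%N -> c h * F h.-1 + b h * F h.+1 = t * F h.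
Proof.
move=> hD.
have tF : t *: radial F = radial (fun h => t * F h).
  by apply/matrixP => r s; rewrite !mxE.
by move: AF; rewrite adjmx_mul_radial tF => /radial_inj/(_ hD).
Qed.

(** As [b h] is nonzero for [h < D], the recurrence determines [F] up to [D] from [F 0]. *)
Lemma radial_eigen_neq0 : radial F != 0 -> F 0%N != 0.
Proof.
apply: contraNneq => F0; apply/eqP.
have -> : 0 = radial (fun=> 0) by apply/matrixP => r s; rewrite !mxE.
apply: eq_radial; elim/ltn_ind => -[//|h IHh] hD.
have := eigen_recurrence (ltnW hD).
rewrite (IHh h.-1) ?(IHh h) ?mulr0 ?add0r; try lia.
by move/eqP; rewrite mulf_eq0 pnatr_eq0 (gtn_eqF (b_gt0 _ _ _ hD)) // => /eqP.
Qed.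

(** The bracket on the left is the factor by which [radial F] followed by [E*_2] multiplies a vector
    of [E*_2 W] with local eigenvalue [b 3 - 1] and entry sum 0. *)
Lemma eigen_vanishing : (4 <= D)%N ->
  b 0 * b 1 * b 2 * (F 0%N + F 2%N * (b 3 - 1) - F 4%N * b 3) =
  t ^+ 2 * (b 0 ^+ 2 - t ^+ 2) * F 0%N.
Proof.
move=> D4.
have cb h : (h <= D)%N -> b 0 = c h + b h.
  by move=> hD; rewrite -natrD (c_plus_b e_simple e_conn e_bip e_dr).
have := @eigen_recurrence 0 isT; rewrite c_0 // mul0r add0r => e0.
have := @eigen_recurrence 1 D_gt0; rewrite c_1 // mul1r /= => e1.
have e2 := @eigen_recurrence 2 (ltnW (ltnW D4)).
have e3 := @eigen_recurrence 3 (ltnW D4).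
rewrite /= in e2 e3.
have := cb 1%N D_gt0; rewrite c_1 // => k1.
have k2 := cb 2%N (ltnW (ltnW D4)); have k3 := cb 3%N (ltnW D4).
(* The recurrence at 3 removes [F 4]; then [1 + b 1 = c 3 + b 3] and the recurrence at 1 apply. *)
have -> : F 0%N + F 2%N * (b 3 - 1) - F 4%N * b 3 = t * (F 1%N - F 3%N).
  have -> : F 4%N * b 3 = t * F 3%N - c 3 * F 2%N by rewrite -e3; ring.
  have -> : b 3 = 1 + b 1 - c 3 by rewrite -k1 k3; ring.
  by rewrite [RHS]mulrBr -e1; ring.
(* Since [c h + b h = b 0], the recurrence at [h] becomes [b h * (F h.-1 - F h.+1) = b 0 * F h.-1 -
   t * F h]; it is taken at 2 and 1. *)
have h2 : b 2 * (F 1%N - F 3%N) = b 0 * F 1%N - t * F 2%N.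
  by rewrite -e2 k2; ring.
have h1 : b 1 * (F 0%N - F 2%N) = b 0 * F 0%N - t * F 1%N.
  by rewrite -e1 k1; ring.
rewrite (_ : b 0 * b 1 * b 2 * _ = t * b 0 * b 1 * (b 2 * (F 1%N - F 3%N))); last by ring.
rewrite h2.
rewrite (_ : _ * _ = t ^+ 2 * (b 0 * (b 1 * (F 0%N - F 2%N)))
   + t * b 1 * b 0 * (b 0 * F 1%N - t * F 0%N)); last by ring.
rewrite h1 e0 subrr mulr0 addr0.
rewrite (_ : b 0 * (_ - _) = b 0 ^+ 2 * F 0%N - t * (b 0 * F 1%N)); last by ring.
by rewrite e0; ring.
Qed.

End Eigenmatrix.

(** * Primitive idempotents and the symmetry of the spectrum *)

Variables (theta : nat -> C) (E : nat -> 'M[C]_#|X|).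
Hypotheses (theta_eig : ordered_eigenvalues e theta)
  (E_idem : idempotents_for e theta E).

Lemma theta_inj i j : (i <= D)%N -> (j <= D)%N -> theta i = theta j -> i = j.
Proof.
move=> iD jD tij; apply/eqP; case: ltngtP => // ij.
  by have := theta_eig.1 i j; rewrite ij jD tij ltxx => /(_ isT).
by have := theta_eig.1 j i; rewrite ij iD tij ltxx => /(_ isT).
Qed.

Lemma idempotent_comm i : (i <= D)%N -> E i *m A = A *m E i.
Proof. by case/E_idem => -[/bose_mesnerP[F ->] _ _ _] _; rewrite adjmx_radialC. Qed.

(** Computing [E_i A E_j] from either side gives [theta i] and [theta j] times [E_i E_j], and
    distinct indices have distinct eigenvalues. *)
Lemma idempotents_mul i j : (i <= D)%N -> (j <= D)%N ->
  E i *m E j = if i == j then E i else 0.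
Proof.
move=> iD jD; have [-> |ij] := eqVneq i j; first by case: (E_idem jD) => -[].
have /eqP : theta i *: (E i *m E j) = theta j *: (E i *m E j).
  rewrite scalemxAl -(E_idem iD).2 -idempotent_comm // -mulmxA (E_idem jD).2.
  by rewrite scalemxAr.
rewrite -subr_eq0 -scalerBl scaler_eq0 subr_eq0 => /orP[/eqP/theta_inj tij|/eqP //].
by case/eqP: ij; apply: tij.
Qed.

(* The E_i are D + 1 independent elements of a span of D + 1 matrices. *)
Lemma sum_idempotents : \sum_(i < D.+1) E i = 1%:M.
Proof.
set S := [tuple E i | i < D.+1].
have S_E (i : 'I_D.+1) : S`_i = E i by rewrite -tnth_nth tnth_mktuple.
have proj (k : 'I_D.+1 -> C) (j : 'I_D.+1) :
    E j *m (\sum_i k i *: S`_i) = k j *: E j.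
  rewrite mulmx_sumr (bigD1 j) // big1 => [|i /= ij].
    by rewrite S_E -scalemxAr idempotents_mul ?leq_ord ?eqxx //= addr0.
  rewrite S_E -scalemxAr idempotents_mul ?leq_ord // eq_sym val_eqE.
  by rewrite (negbTE ij) scaler0.
have E_neq0 (j : 'I_D.+1) : E j != 0 by case: (E_idem (ltn_ord j : j <= D)%N) => -[].
have freeS : free S.
  apply/freeP => k k0 j; have := proj k j; rewrite k0 mulmx0 => /esym/eqP.
  by rewrite scaler_eq0 (negbTE (E_neq0 j)) orbF => /eqP.
have spanS : <<S>>%VS = bose_mesner C e.
  apply/eqP; rewrite eqEdim; apply/andP; split.
    apply/span_subvP => M /mapP[i _ ->].
    by case: (E_idem (ltn_ord i : i <= D)%N) => -[].
  move: freeS; rewrite /free => /eqP ->; rewrite size_tuple.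
  by apply: leq_trans (dim_span _) _; rewrite size_mkseq.
have : 1%:M \in <<S>>%VS by rewrite spanS bose_mesner1.
move/coord_span => one; rewrite [RHS]one; apply: eq_bigr => j _.
(* Multiplying the expansion of the identity by [E j] shows that its coefficient at [j] is 1. *)
have := proj (fun i => coord S i 1%:M) j; rewrite -one mulmx1 => /eqP.
rewrite -{1}[E j]scale1r -subr_eq0 -scalerBl scaler_eq0 (negbTE (E_neq0 j)) orbF.
by rewrite subr_eq0 S_E => /eqP <-; rewrite scale1r.
Qed.

Lemma sum_adjmx s : \sum_r A r s = b 0.
Proof.
have := sum_neighbours e_simple e_conn e_bip e_dr (fun=> 1 : C) (enum_val s) (enum_val s).
have /eqP -> : dist e (enum_val s) (enum_val s) == 0%N by rewrite dist_eq0.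
rewrite c_0 // mul0r add0r mulr1 => <-; rewrite -sum_enum_val.
by apply: eq_bigr => r _; rewrite !mxE mulr1 dist_sym.
Qed.

Lemma eigenvalue_valency : eigenvalue A (b 0).
Proof.
apply/eigenvalueP; exists (const_mx 1).
  apply/matrixP => r s; rewrite !mxE mulr1 -(sum_adjmx s).
  by apply: eq_bigr => t _; rewrite !mxE mul1r.
have [y _] := dist_attained e_conn (leq0n _) D_gt0.
apply/eqP => /matrixP/(_ 0 (enum_rank y))/eqP.
by rewrite !mxE oner_eq0.
Qed.

(** Sum the triangle inequality over the entries of [v *m A]; every row of [A] sums to the
    valency. *)
Lemma eigenvalue_le_valency a : eigenvalue A a -> `|a| <= b 0.
Proof.
case/eigenvalueP => v va v0.
have v_gt0 : 0 < \sum_s `|v 0 s|.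
  rewrite lt_def sumr_ge0 // andbT; apply: contraNneq v0 => /psumr_eq0P v_eq0.
  apply/eqP/matrixP => r s; rewrite ord1 mxE; apply/normr0_eq0/v_eq0 => //.
rewrite -(ler_pM2r v_gt0) mulr_sumr.
have -> : \sum_s `|a| * `|v 0 s| = \sum_s `|\sum_r v 0 r * A r s|.
  apply: eq_bigr => s _; have := congr1 (fun u : 'rV_ _ => u 0 s) va.
  by rewrite !mxE -normrM => ->.
apply: le_trans (_ : _ <= \sum_s \sum_r `|v 0 r * A r s|) _.
  by apply: ler_sum => s _; exact: ler_norm_sum.
rewrite exchange_big mulr_sumr; apply: ler_sum => r _ /=.
rewrite -(sum_adjmx r) mulrC mulr_sumr ler_sum // => s _.
by rewrite normrM !mxE dist_sym // [`|_%:R|]ger0_norm ?ler0n.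
Qed.

(** Changing the sign of the entries at odd distance from a fixed vertex conjugates [A] into its
    negative. *)
Lemma eigenvalue_opp a : eigenvalue A a -> eigenvalue A (- a).
Proof.
case/eigenvalueP => v va v0; have [x _] := dist_attained e_conn (leq0n _) D_gt0.
pose sg (r : 'I_#|X|) : C := (-1) ^+ dist e x (enum_val r).
apply/eigenvalueP; exists (\row_r (sg r * v 0 r)).
  apply/matrixP => r s; rewrite ord1 !mxE.
  have := congr1 (fun u : 'rV_ _ => u 0 s) va; rewrite !mxE => vas.
  rewrite (_ : - a * _ = - sg s * (a * v 0 s)); last by ring.
  rewrite -vas mulr_sumr; apply: eq_bigr => t _; rewrite !mxE.
  have [ts|_] := eqVneq (dist e (enum_val t) (enum_val s)) 1%N; last by rewrite !mulr0.
  rewrite !mulr1; congr (_ * _); rewrite /sg -signr_odd -[in RHS]signr_odd.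
  rewrite (odd_dist e_conn e_bip x (enum_val t) (enum_val s)) ts addbT.
  by case: (odd _); rewrite ?expr0 ?expr1 ?opprK.
apply: contraNneq v0 => sv0; apply/eqP/matrixP => r s; rewrite ord1 mxE.
have /eqP := congr1 (fun u : 'rV_ _ => u 0 s) sv0.
by rewrite !mxE mulf_eq0 signr_eq0 => /eqP.
Qed.

(** The spectrum is closed under negation, so both sides list it in strictly decreasing order, and
    such a list is unique. *)
Lemma theta_sym i : (i <= D)%N -> theta i = - theta (D - i)%N.
Proof.
have [theta_lt theta_spec] := theta_eig.
pose s1 := mkseq theta D.+1; pose s2 := mkseq (fun i => - theta (D - i)%N) D.+1.
have gt_trans : transitive (fun y z : C => z < y).
  by move=> y z w yz wy; exact: lt_trans wy yz.
have sorted_mkseq (f : nat -> C) : (forall i j, (i < j <= D)%N -> f j < f i) ->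
    sorted (fun y z : C => z < y) (mkseq f D.+1).
  move=> f_lt; apply/(sortedP 0) => j; rewrite size_mkseq ltnS => jD.
  by rewrite !nth_mkseq ?f_lt ?ltnSn //; lia.
have s12 : s1 = s2.
  apply: (irr_sorted_eq gt_trans); first by move=> y; rewrite ltxx.
  - exact: sorted_mkseq.
  - apply: sorted_mkseq => j l jl; rewrite ltrN2 theta_lt //; lia.
  move=> a; apply/mapP/mapP => -[j]; rewrite mem_iota add0n ltnS => /andP[_ jD].
    have /theta_spec/eigenvalue_opp : exists2 i, (i <= D)%N & theta j = theta i by exists j.
    case/theta_spec => l lD tl ->; exists (D - l)%N.
      by rewrite mem_iota; lia.
    by rewrite subKn // -tl opprK.
  have : exists2 i, (i <= D)%N & theta (D - j)%N = theta i by exists (D - j)%N => //; lia.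
  move=> /theta_spec/eigenvalue_opp/theta_spec[l lD ->] ->; exists l => //.
  by rewrite mem_iota.
by move=> iD; rewrite -[LHS](nth_mkseq 0 theta (iD : i < D.+1)%N) -/s1 s12 nth_mkseq.
Qed.

Lemma theta_0 : theta 0%N = b 0.
Proof.
have [theta_lt theta_spec] := theta_eig.
have /theta_spec[j jD kj] := eigenvalue_valency.
have k_le : b 0 <= theta 0%N.
  rewrite kj; case: j jD {kj} => // j jD; exact/ltW/theta_lt.
apply/eqP; rewrite eq_le k_le andbT.
rewrite -(ger0_norm (le_trans (ler0n _ _) k_le)) eigenvalue_le_valency //.
by apply/theta_spec; exists 0%N.
Qed.

Lemma theta_half : ~~ odd D -> theta D./2 = 0.
Proof.
move=> evenD; have := odd_double_half D; rewrite (negbTE evenD) add0n => DD.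
have half : (D - D./2 = D./2)%N by rewrite -{1}DD -addnn addnK.
have hD : (D./2 <= D)%N by rewrite -{2}DD -addnn leq_addr.
have /eqP := theta_sym hD; rewrite half -subr_eq0 opprK -mulr2n mulrn_eq0.
by move/eqP.
Qed.

(** The first factor singles out [theta D./2 = 0]; the second singles out the valency and its
    negative, which are [theta 0] and [theta D]. *)
Lemma theta_vanishing i : ~~ odd D -> (i <= D)%N ->
  (theta i ^+ 2 * (b 0 ^+ 2 - theta i ^+ 2) == 0) = (i \in [:: 0; D./2; D]%N).
Proof.
move=> evenD iD; rewrite -theta_0 subr_sqr !mulf_eq0 orbb subr_eq0 !inE.
rewrite addrC addr_eq0 (theta_sym (leq0n _)) subn0 opprK -(theta_half evenD).
have hD : (D./2 <= D)%N by lia.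
have eqt l m : (l <= D)%N -> (m <= D)%N -> (theta l == theta m) = (l == m).
  by move=> lD mD; apply/eqP/eqP => [/theta_inj->|->].
rewrite eqt // -(eqt i 0%N) // (theta_sym (leq0n _)) subn0 -(eqt i D) //.
by rewrite [theta i == - _]eq_sym; do 3!case: (_ == _).
Qed.

(** * Radial matrices acting on vectors supported at distance 2 from [x] *)

Lemma dual_idemE x i (w : 'cV[C]_#|X|) r :
  (dual_idem C e x i *m w) r 0 = (dist e x (enum_val r) == i)%:R * w r 0.
Proof. exact: layerE. Qed.

(** By parity and the triangle inequality, two vertices at distance 2 from [x] are at mutual
    distance 0, 2 or 4. The sums of [v] over distances 0 and 2 from [r] are [v r 0] and
    [eta * v r 0]; the vanishing total yields the sum over distance 4. *)
Lemma dual_idem_radial x (v : 'cV[C]_#|X|) eta F :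
  dual_idem C e x 2 *m v = v ->
  dual_idem C e x 2 *m (distmx C e 2 *m v) = eta *: v ->
  \sum_s v s 0 = 0 ->
  dual_idem C e x 2 *m (radial F *m v) =
    (F 0%N + F 2%N * eta - F 4%N * (1 + eta)) *: v.
Proof.
move=> Pv A2v sum0.
pose g (r : 'I_#|X|) := dist e x (enum_val r).
have v_layer s : g s != 2%N -> v s 0 = 0.
  by move=> /negbTE gs; rewrite -Pv dual_idemE -/(g s) gs mul0r.
apply/matrixP => r j; rewrite ord1 {j} dual_idemE -/(g r) [RHS]mxE.
have [gr|gr] := eqVneq (g r) 2%N; last by rewrite mul0r v_layer // mulr0.
rewrite mul1r mxE.
pose S h := \sum_s (dist e (enum_val r) (enum_val s) == h)%:R * v s 0.
have S0 : S 0%N = v r 0.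
  rewrite /S (bigD1 r) //= dist_eq0 // eqxx mul1r big1 ?addr0 // => s sr.
  by rewrite dist_eq0 // (inj_eq enum_val_inj) eq_sym (negbTE sr) mul0r.
have S2 : S 2%N = eta * v r 0.
  have := congr1 (fun u : 'cV_ _ => u r 0) A2v.
  rewrite dual_idemE -/(g r) gr eqxx mul1r !mxE => <-.
  by apply: eq_bigr => s _; rewrite mxE.
have dist_rs s : v s 0 != 0 ->
    dist e (enum_val r) (enum_val s) \in [:: 0; 2; 4]%N.
  move=> vs; have gs : g s = 2%N by apply/eqP; apply: contraNT vs => /v_layer ->.
  have := odd_dist e_conn e_bip (enum_val r) x (enum_val s).
  have := dist_triangle e_conn (enum_val r) x (enum_val s).
  rewrite [dist e _ x]dist_sym // -/(g r) -/(g s) gr gs /= !inE.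
  by case: (dist e _ _) => [|[|[|[|[|]]]]].
have S4 : S 0%N + S 2%N + S 4%N = 0.
  rewrite -sum0 -!big_split; apply: eq_bigr => s _ /=.
  have [->|/dist_rs] := eqVneq (v s 0) 0; first by rewrite !mulr0 !addr0.
  by rewrite !inE => /or3P[] /eqP -> /=; rewrite !mul0r ?mul1r ?add0r ?addr0.
have -> : \sum_s radial F r s * v s 0 = F 0%N * S 0%N + F 2%N * S 2%N + F 4%N * S 4%N.
  rewrite !mulr_sumr -!big_split; apply: eq_bigr => s _ /=; rewrite mxE.
  have [->|/dist_rs] := eqVneq (v s 0) 0; first by rewrite !mulr0 !addr0.
  by rewrite !inE => /or3P[] /eqP -> /=; rewrite !mul0r !mulr0 ?mul1r ?add0r ?addr0.
have -> : S 4%N = - (S 0%N + S 2%N) by rewrite -[RHS]addr0 -S4; ring.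
by rewrite S0 S2; ring.
Qed.

End BoseMesner.

(** * Counting the nonzero components *)

Lemma sum_notin N (s : seq nat) : uniq s -> all (gtn N) s ->
  (\sum_(i < N) (val i \notin s) + size s)%N = N.
Proof.
move=> us sN; have -> : size s = (\sum_(i < N) (val i \in s))%N.
  elim: s us sN => [|a s IHs] /=; first by rewrite big1.
  move=> /andP[as_ us] /andP[aN sN]; rewrite (IHs us sN).
  rewrite (bigD1 (Ordinal aN)) // [in RHS](bigD1 (Ordinal aN)) //=.
  rewrite mem_head (negbTE as_) add0n add1n; congr _.+1.
  by apply: eq_bigr => i ia; rewrite inE -val_eqE /= in ia *; rewrite (negbTE ia).
rewrite -big_split /= (eq_bigr (fun=> 1%N)) ?sum1_card ?card_ord // => i _.
by case: (_ \in _).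
Qed.

Lemma sum_notin_half D : ~~ odd D -> (4 <= D)%N ->
  (\sum_(i < D.+1) (val i \notin [:: 0; D./2; D]) = D - 2)%N.
Proof.
move=> evenD D4; have := odd_double_half D; rewrite (negbTE evenD) -addnn => DD.
have : (\sum_(i < D.+1) (val i \notin [:: 0; D./2; D]) + 3 = D.+1)%N.
  by apply: (@sum_notin D.+1 [:: 0; D./2; D]%N); rewrite /= ?inE; lia.
lia.
Qed.

(** Of the [D - 1] places from 2 to [D] exactly one is empty. An empty place before [D] would empty
    [D] as well, so the empty one is [D]. *)
Lemma gapless_dims D (f : nat -> nat) : (4 <= D)%N ->
  (forall i, (i <= D)%N -> (f i <= 1)%N) -> (forall i, (i < 2)%N -> f i = 0%N) ->
  (0 < f 2)%N ->
  (forall j, (2 <= j)%N -> f j.+1 = 0%N -> forall i, (j < i)%N -> f i = 0%N) ->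
  (\sum_(i < D.+1) f i = D - 2)%N ->
  f D = 0%N /\ forall i, (2 <= i <= D - 1)%N -> f i = 1%N.
Proof.
move=> D4 f_le1 f01 f2 gap sum_f.
have f_mid i : (2 <= i <= D - 1)%N -> f i = 1%N.
  move=> i_mid; apply/eqP; rewrite eqn_leq f_le1 /= ?lt0n; last by lia.
  apply/eqP => fi0; case: i => [|[|[|j]]] in i_mid fi0 *; rewrite ?fi0 // in i_mid f2.
  have fD : f D = 0%N by apply: gap fi0 _ _ => //; lia.
  have cnt : (\sum_(i < D.+1) (val i \notin [:: 0; 1; j.+3; D]) + 4 = D.+1)%N.
    by apply: (@sum_notin D.+1 [:: 0; 1; j.+3; D]%N); rewrite /= ?inE; lia.
  have : (\sum_(i < D.+1) f i <= \sum_(i < D.+1) (val i \notin [:: 0; 1; j.+3; D]))%N.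
    apply: leq_sum => i _; have [|_] := boolP (val i \in _).
      by rewrite !inE => /or4P[] /eqP ->; rewrite ?fi0 ?fD // f01.
    by apply: f_le1; rewrite -ltnS.
  by rewrite sum_f; lia.
split=> //; apply/eqP; rewrite -leqn0 -ltnS ltnNge; apply/negP => fD.
have cnt : (\sum_(i < D.+1) (val i \notin [:: 0; 1]) + 2 = D.+1)%N.
  by apply: (@sum_notin D.+1 [:: 0; 1]%N); rewrite /= ?inE; lia.
have : (\sum_(i < D.+1) (val i \notin [:: 0; 1]) <= \sum_(i < D.+1) f i)%N.
  apply: leq_sum => i _; rewrite /=; move: (nat_of_ord i) (ltn_ord i) => {i} i iD.
  rewrite !inE; have [->//|iD'] := eqVneq i D; first by rewrite (leq_trans (leq_b1 _)).
  by have [//|/norP[i0 i1]] := boolP (_ || _); rewrite f_mid //; lia.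
by rewrite sum_f; lia.
Qed.

(** * Dimensions of the thin module [W] and of its components *)

Theorem theorem14p8 (R : realType) (X : finType) (e : rel X) (D : nat)
  (theta : nat -> R[i]) (E : nat -> 'M[R[i]]_#|X|)
  (x : X) (W : {vspace 'cV[R[i]]_#|X|}) :
  simple_graph e -> connected_graph e -> bipartite e -> distance_regular e ->
  diameter e = D -> ~~ odd D -> (4 <= D)%N -> (3 <= valency e)%N ->
  ordered_eigenvalues e theta -> idempotents_for e theta E ->
  irreducible_T_module e x W -> thin e x W -> endpoint e x W = 2%N ->
  local_eigenvalue e x W (theta_tilde e (theta D./2)) ->
  [/\ \dim W = (D - 2)%N,
      forall i, (i <= D)%N ->
        (i \in [:: 0; 1; D]%N -> mximg (dual_idem R[i] e x i) W = 0%VS) /\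
        ((2 <= i <= D - 1)%N -> \dim (mximg (dual_idem R[i] e x i) W) = 1%N)
    & forall i, (i <= D)%N ->
        (i \in [:: 0; D./2; D]%N -> mximg (E i) W = 0%VS) /\
        ((1 <= i <= D - 1)%N -> i != D./2 -> \dim (mximg (E i) W) = 1%N)].
Proof.
move=> e_simple e_conn e_bip e_dr; set C : numClosedFieldType := R[i].
move=> <-{D} evenD D4 _ theta_eig E_idem [TW W0 irrW] thinW W_end loc.
set D := diameter e in evenD D4 loc *.
have D2 : (2 <= D)%N by rewrite (leq_trans _ D4).
have D_gt0 := ltnW D2.
pose g (r : 'I_#|X|) := dist e x (enum_val r).
pose A := adjmx C e; pose P := dual_idem C e x.
have le_gD r : (g r <= D)%N by exact: dist_le_diameter.
have A_band r s : A r s != 0 -> (g r <= (g s).+1)%N && (g s <= (g r).+1)%N.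
  rewrite mxE; have [/eqP|_] := eqVneq (dist e _ _) 1%N; last by rewrite eqxx.
  rewrite dist_eq1 // => rs _; rewrite /g ![dist e x _]dist_sym //.
  by rewrite !dist_edge // e_simple.1.
have AW w : w \in W -> A *m w \in W by apply: TW; apply: generated_gen; left.
have PW i w : (i <= D)%N -> w \in W -> P i *m w \in W.
  by move=> iD; apply: TW; apply: generated_gen; right; exists i.
(* Invariance under the generators extends to all of [terwilliger] by induction on the generated
   algebra. *)
have irrW' (U : {vspace 'cV[C]_#|X|}) : (U <= W)%VS ->
    (forall u, u \in U -> A *m u \in U) ->
    (forall i u, (i <= D)%N -> u \in U -> P i *m u \in U) -> U = 0%VS \/ U = W.
  move=> UW AU PU; apply: irrW UW => B0 TB0; elim: B0 / TB0 => [B [->|[i iD ->]]||a B _ IHB|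
      B B' _ IHB _ IHB'|B B' _ IHB _ IHB'] w wU.
  - exact: AU.
  - exact: PU.
  - by rewrite mul1mx.
  - by rewrite -scalemxAl memvZ ?IHB.
  - by rewrite mulmxDl memvD ?IHB ?IHB'.
  - by rewrite -mulmxA IHB ?IHB'.
(* As [endpoint] is a [find], its value 2 means that the test fails below 2 and succeeds at 2. *)
have PW0 i : (i < 2)%N -> mximg (P i) W = 0%VS.
  move=> i2; have := @before_find _ 0%N (fun i => mximg (P i) W != 0%VS) (iota 0 D.+1) i.
  rewrite -/(endpoint e x W) W_end nth_iota ?add0n; last by lia.
  by move/(_ i2)/negbFE/eqP.
have PW2 : mximg (P 2) W != 0%VS.
  have := @nth_find _ 0%N (fun i => mximg (P i) W != 0%VS) (iota 0 D.+1).
  rewrite has_find -/(endpoint e x W) W_end size_iota nth_iota ?add0n; last by lia.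
  by apply; lia.
have W_above w : w \in W -> supported_on g (leq 2) w.
  move=> wW r; rewrite -ltnNge => gr.
  have /eqP/mximg_eq0P/(_ w wW) := PW0 _ gr.
  by move/(layer_eq0P g); apply.
have [v /mximgP[v' v'W vE] [v0 locv]] := loc.
have Pv : P 2 *m v = v by rewrite vE mulmxA (mul_layer C g) eqxx.
have vW : v \in W by rewrite vE PW.
have W_2 : exists2 w, w \in W & P 2 *m w != 0 by exists v; rewrite ?Pv.
have EW i w : (i <= D)%N -> w \in W -> E i *m w \in W.
  move=> iD; apply: bose_mesner_mul TW _ => //.
  by case: (E_idem i iD) => -[].
have b2_neq0 : (b_ e 2)%:R != 0 :> C by rewrite pnatr_eq0 -lt0n b_gt0 //; lia.
(* With [theta D./2 = 0] the inverted term is the negative of [b_ e 2], which cancels. *)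
have eta_b : theta_tilde e (theta D./2) = (b_ e 3)%:R - 1.
  rewrite /theta_tilde (theta_half e_conn e_bip D_gt0 theta_eig evenD) expr0n sub0r invrN mulrN opprK.
  by rewrite mulrAC mulfV // mul1r addrC.
rewrite eta_b -!mulmxA [dual_idem _ _ _ _ *m v]Pv in locv.
(* The entry of [A_2 v] at [x] is the sum of [v], because [v] lives at distance 2; it vanishes since
   [E*_0 W = 0]. *)
have sum_v : \sum_s v s 0 = 0.
  have dW : distmx C e 2 *m v \in W.
    apply: TW vW; apply: terwilliger_distmx => //; rewrite -/D; lia.
  have /eqP/mximg_eq0P/(_ _ dW) := PW0 0%N isT.
  move/(layer_eq0P g)/(_ (enum_rank x)); rewrite /g enum_rankK.
  have /eqP dxx : dist e x x == 0%N by rewrite dist_eq0.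
  move=> /(_ dxx) d0; rewrite -[RHS]d0 mxE; apply: eq_bigr => s _.
  by rewrite mxE enum_rankK -{1}Pv dual_idemE.
have E_v i : (i <= D)%N -> (E i *m v == 0) = (i \in [:: 0; D./2; D]%N).
  move=> iD; have [[EB Ei0 _ _] AE] := E_idem i iD.
  have [F EF] := bose_mesnerP EB.
  rewrite EF in AE Ei0.
  have F0 : F 0%N != 0 by apply: (radial_eigen_neq0 e_simple e_conn e_bip e_dr D_gt0 AE).
  pose q := F 0%N + F 2%N * ((b_ e 3)%:R - 1) - F 4%N * (b_ e 3)%:R.
  have PEv : P 2 *m (E i *m v) = q *: v.
    rewrite EF (dual_idem_radial e_simple e_conn e_bip F Pv locv sum_v).
    by rewrite [1 + _]addrC subrK.
  have qE := eigen_vanishing e_simple e_conn e_bip e_dr D_gt0 AE D4.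
  rewrite -/q in qE; rewrite -EF in AE.
  have bbb : (b_ e 0)%:R * (b_ e 1)%:R * (b_ e 2)%:R != 0 :> C.
    by rewrite !mulf_neq0 // pnatr_eq0 -lt0n b_gt0 // -/D; lia.
  rewrite -(theta_vanishing e_simple e_conn e_bip e_dr D_gt0 theta_eig evenD iD).
  rewrite -[RHS](mulIr_eq0 _ (mulIf F0)) -qE mulf_eq0 (negbTE bbb) /=.
  apply/eqP/eqP => [Ev|q0].
    by move: PEv; rewrite Ev mulmx0 => /esym/eqP; rewrite scaler_eq0 (negbTE v0) orbF => /eqP.
  (* If [q = 0], then [E i *m v] is an eigenvector in [W] without component in layer 2. *)
  apply: (eigenvector_layer_neq0 le_gD A_band AW PW irrW' thinW W_above W_2).
  - exact: EW.
  - by rewrite mulmxA AE -scalemxAl.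
  - by rewrite -/(P 2) PEv q0 scale0r.
have EW0 i : (i <= D)%N -> i \in [:: 0; D./2; D]%N -> mximg (E i) W = 0%VS.
  move=> iD; rewrite -E_v // => Ev.
  (* The kernel of [E i] in [W] is invariant under [A], which commutes with [E i]; containing [v],
     it is all of [W]. *)
  pose U := (W :&: lker (linfun (mulmx (E i))))%VS.
  have UE u : u \in U = (u \in W) && (E i *m u == 0) by rewrite memv_cap mem_lker_mul.
  have UW : U = W.
    apply: (cyclic_submodule le_gD A_band AW PW irrW' thinW D2 W_above W_2 vW Pv v0).
    - by rewrite UE vW Ev.
    - exact: capvSl.
    move=> u; rewrite !UE => /andP[uW /eqP Eu]; rewrite AW //=.
    rewrite mulmxA (idempotent_comm e_simple e_conn e_bip e_dr E_idem iD).
    by rewrite -mulmxA Eu mulmx0.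
  apply/eqP/mximg_eq0P => w; rewrite -UW UE => /andP[_ /eqP] //.
have EW1 i : (i <= D)%N -> i \notin [:: 0; D./2; D]%N -> \dim (mximg (E i) W) = 1%N.
  move=> iD; rewrite -E_v // => Ev0.
  have AEi w : A *m (E i *m w) = theta i *: (E i *m w).
    by rewrite mulmxA (E_idem i iD).2 -scalemxAl.
  have P_inj w : w \in W -> A *m w = theta i *: w -> P 2 *m w = 0 -> w = 0.
    exact: (eigenvector_layer_neq0 le_gD A_band AW PW irrW' thinW W_above W_2).
  have PEv : P 2 *m (E i *m v) != 0.
    by apply: contraNneq Ev0 => PEv; apply/eqP/P_inj; rewrite ?EW.
  (* Thinness makes the layer-2 parts of [E i *m w] and [E i *m v] proportional. The corresponding
     difference is an eigenvector without layer-2 part, hence zero. *)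
  have EWv : (mximg (E i) W <= <[E i *m v]>)%VS.
    apply/subvP => _ /mximgP[w wW ->].
    have [a PEw] := layer_mximg_scale thinW D2 (EW _ _ iD vW) PEv (EW _ _ iD wW).
    rewrite (_ : E i *m w = a *: (E i *m v)) ?memvZ ?memv_line //.
    apply/eqP; rewrite -subr_eq0; apply/eqP/P_inj; first by rewrite memvB ?memvZ ?EW.
      by rewrite mulmxBr -scalemxAr !AEi scalerBr !scalerA [a * _]mulrC.
    by rewrite mulmxBr -scalemxAr PEw subrr.
  apply/eqP; rewrite eqn_leq (leq_trans (dimvS EWv)) ?dim_vline ?leq_b1 //= lt0n.
  rewrite dimv_eq0; apply: contraNneq Ev0 => /eqP/mximg_eq0P/(_ v vW) -> //.
have dimW : \dim W = (D - 2)%N.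
  rewrite (@dim_idempotents _ _ D.+1 E W); last first.
  - by move=> i w iD; apply: EW.
  - exact: (sum_idempotents e_simple e_conn e_bip e_dr theta_eig).
  - by move=> i j iD jD; apply: (idempotents_mul e_simple e_conn e_bip e_dr theta_eig).
  rewrite -(sum_notin_half evenD D4).
  apply: eq_bigr => i _; have iD : (i <= D)%N by rewrite -ltnS.
  by have [/EW0|/EW1] := boolP (val i \in _) => ->; rewrite ?dimv0.
pose f i := \dim (mximg (P i) W).
have sum_f : (\sum_(i < D.+1) f i = D - 2)%N.
  rewrite -dimW (@dim_idempotents _ _ D.+1 P W) //.
  - by move=> i j _ _; exact: (mul_layer C g).
  - exact: (sum_layer C le_gD).
have [fD f_mid] : f D = 0%N /\ forall i, (2 <= i <= D - 1)%N -> f i = 1%N.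
  apply: gapless_dims => //; first by move=> i i2; rewrite /f PW0 ?dimv0.
    by rewrite lt0n dimv_eq0.
  move=> j j2 /eqP; rewrite dimv_eq0 => /eqP fj0 i ji.
  by rewrite /f (layer_gap A_band AW PW irrW' D2 W_2 j2 fj0 ji) dimv0.
split=> // i iD; split.
- rewrite !inE => /or3P[] /eqP ->; try exact: PW0.
  by apply/eqP; rewrite -dimv_eq0; apply/eqP.
- exact: f_mid.
- exact: EW0.
- move=> i_mid id; apply: EW1 => //; rewrite !inE !negb_or id /=.
  by apply/andP; split; apply/eqP; lia.
Qed.
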